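(* Let $x_1,\ldots,x_n$ be real numbers, $s_k=\sum_{i=1}^k x_i$, and let $\hat s_1=s_1$, $\hat s_k=(\hat s_{k-1}+x_k)(1+\delta_k)$ for $2\le k\le n$, where $\delta_2,\ldots,\delta_n$ are independent random variables with mean zero and $|\delta_k|\le u$, with $0<u<1$. Let $E_n=\hat s_n-s_n$ and $\mathbf{s}_n=[s_2,\ldots,s_n]$. Then for any $\delta\in(0,1)$, with probability at least $1-\delta$, \[ |E_n| \le u\,\|\mathbf{s}_n\|_2\,\lambda(\delta/2)\,\bigl(1+\tilde\gamma_n(\delta/2)\bigr). \]
   Context: For $\delta\in(0,1)$, $\lambda(\delta)=\sqrt{2\log(2/\delta)}$ and $\tilde\gamma_n(\delta)=\exp\!\left(\frac{\lambda(\delta)\sqrt{n}\,u+nu^2}{1-u}\right)-1$. The recurrence models recursive summation in floating-point arithmetic with unit roundoff $u$; $\delta_k$ is the relative rounding error at step $k$. *)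

(* Defs.v *)
From HB Require Import structures.
From mathcomp Require Import all_boot all_order all_algebra.
From mathcomp Require Import all_classical all_reals all_analysis.
Set Implicit Arguments. Unset Strict Implicit. Unset Printing Implicit Defensive.
Import Order.TTheory GRing.Theory Num.Theory.
Local Open Scope classical_set_scope.
Local Open Scope ring_scope.

Section Defs.
Context {d : measure_display} {T : measurableType d} {R : realType}.

Definition mutually_independent (P : probability T R) (I : set nat)
    (X : nat -> {RV P >-> R}) : Prop :=
  forall (J : seq nat), uniq J -> (forall j, j \in J -> I j) ->
  forall (B : nat -> set R), (forall j, measurable (B j)) ->
  P (\bigcap_(j in [set j | j \in J]) (X j @^-1` B j)) =
  (\prod_(j <- J) P (X j @^-1` B j))%E.

Definition psum (x : nat -> R) (k : nat) : R := \sum_(1 <= i < k.+1) x i.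

(* computed sums: shat_1 = s_1 = x_1,
   shat_k = (shat_{k-1} + x_k)(1 + delta_k) for k >= 2.
   (shat_0 := 0 is an unused convention.) *)
Fixpoint shat (x : nat -> R) (delta : nat -> T -> R) (k : nat) (w : T) : R :=
  match k with
  | 0 => 0
  | 1 => x 1%N
  | k'.+1 => (shat x delta k' w + x k) * (1 + delta k w)
  end.

Definition lam (dl : R) : R := Num.sqrt (2 * ln (2 / dl)).

Definition gtilde (n : nat) (u dl : R) : R :=
  expR ((lam dl * Num.sqrt n%:R * u + n%:R * u ^+ 2) / (1 - u)) - 1.

Definition snorm (x : nat -> R) (n : nat) : R :=
  Num.sqrt (\sum_(2 <= k < n.+1) psum x k ^+ 2).

End Defs.
Arguments mutually_independent {d T R} P I X.

(* Main.v *)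
Require Import Defs.
From HB Require Import structures.
From mathcomp Require Import all_boot all_order all_algebra.
From mathcomp Require Import all_classical all_reals all_analysis measurable_realfun.
From mathcomp Require Import ring lra.
Set Implicit Arguments. Unset Strict Implicit. Unset Printing Implicit Defensive.
Import Order.TTheory GRing.Theory Num.Theory.
Import numFieldNormedType.Exports.
Local Open Scope classical_set_scope.
Local Open Scope ring_scope.

(* The error is E_n = sum_k s_k delta_k prod_(j > k) (1 + delta_j), a martingale
   transform of the delta's read backwards: the coefficient of delta_k depends on
   delta_(k+1), ..., delta_n only.  With Y_i = delta_(n-i), stop the transform when
   Y_0 + ... + Y_(i-1) first exceeds t = u lambda sqrt(n-1).  As
   prod (1 + Y_j) <= exp (sum Y_j), the stopped coefficients are at most
   |s_k| exp t, so Azuma's inequality bounds each tail of the stopped sum by dl/4.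
   Stopping occurs only if the stopped sum of the Y_i itself exceeds t, which
   by Azuma again has probability at most dl/4; so the bound fails with probability
   at most 3 dl/4. *)

(** * Hoeffding's lemma, in a pointwise form *)

Lemma leq_exp2_fact (n : nat) : (2 ^ n * n`! <= (2 * n)`!)%N.
Proof.
elim: n => // n IH; rewrite factS expnS.
have -> : (2 * 2 ^ n * (n.+1 * n`!) = (2 * n.+1) * (2 ^ n * n`!))%N.
  by rewrite -!mulnA; congr (2 * _)%N; rewrite mulnCA.
rewrite (_ : (2 * n.+1)%N = (2 * n).+2); last by rewrite mulnS.
rewrite !factS leq_mul// (leq_trans IH)//.
by rewrite -[X in (X <= _)%N]mul1n leq_mul.
Qed.

(** Power series are compared term by term: the odd terms on the left cancel, and [leq_exp2_fact]
    compares the even coefficients 1/(2n)! with 1/(2^n n!). Only partial sums of even length are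
    taken on the left, a subsequence with the same limit. *)
Lemma cosh_le_expR_sqr (R : realType) (a : R) :
  expR a + expR (- a) <= 2 * expR (a ^+ 2 / 2).
Proof.
have even_partial_sums (b : R) :
    series (exp_coeff b) (2 * n)%N @[n --> \oo] --> expR b.
  have /cvg_comp := @cvg_mulnl 2 isT; apply.
  exact: (is_cvg_series_exp_coeff b).
have le n : series (exp_coeff a) (2 * n)%N + series (exp_coeff (- a)) (2 * n)%N
    <= 2 * series (exp_coeff (a ^+ 2 / 2)) n.
  elim: n => [|n IH]; first by rewrite /series/= !big_geq// mulr0 addr0.
  have coefE (b : R) k : exp_coeff b k = b ^+ k / k`!%:R by [].
  have evenE : (- a) ^+ (2 * n) = a ^+ (2 * n) by rewrite exprM sqrrN -exprM.
  rewrite mulnS !seriesSr !coefE ![_ ^+ (2 * n).+1]exprSr evenE.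
  rewrite expr_div_n -exprM.
  set p := a ^+ (2 * n); set S := series _ _ in IH *.
  set S' := series _ _ in IH *; set S'' := series _ _ in IH *.
  have p0 : 0 <= p by rewrite /p exprM exprn_ge0// sqr_ge0.
  have : p / (2 * n)`!%:R <= p / 2 ^+ n / n`!%:R.
    rewrite -mulrA -invfM -natrX -natrM ler_wpM2l//.
    have h : (0 < 2 ^ n * n`!)%N by rewrite muln_gt0 expn_gt0 fact_gt0.
    rewrite lef_pV2 ?posrE ?ltr0n ?fact_gt0//.
    by rewrite ler_nat leq_exp2_fact.
  set x := p / _; set y := p / _ / _ => xy.
  have -> : S + x + p * a / (2 * n).+1`!%:R +
      (S' + x + p * - a / (2 * n).+1`!%:R) = (S + S') + 2 * x by ring.
  by rewrite mulrDr lerD// ler_pM2l.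
have h1 : series (exp_coeff a) (2 * n)%N + series (exp_coeff (- a)) (2 * n)%N
    @[n --> \oo] --> expR a + expR (- a) by exact: cvgD.
have h2 : 2 * series (exp_coeff (a ^+ 2 / 2)) n @[n --> \oo] -->
    2 * expR (a ^+ 2 / 2).
  by apply: cvgMr; exact: is_cvg_series_exp_coeff.
rewrite -(cvg_lim (@Rhausdorff _) h1) -(cvg_lim (@Rhausdorff _) h2).
apply: ler_lim; [exact: cvgP h1|exact: cvgP h2|exact: nearW].
Qed.

(* On [-u, u] the convex function y |-> exp(y g) lies below its chord, whose
   value at 0 is cosh (u g). *)
Lemma expRM_le_chord (R : realType) (u y g : R) : 0 < u -> `|y| <= u ->
  expR (y * g) <= expR ((u * g) ^+ 2 / 2) +
    y * ((expR (u * g) - expR (- (u * g))) / (2 * u)).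
Proof.
move=> u0; rewrite ler_norml => /andP[uy yu].
(* The weight that writes y as a convex combination of u and -u. *)
pose t := (1 + y / u) / 2.
have t01 : 0 <= t <= 1.
  have : -1 <= y / u by rewrite ler_pdivlMr// mulN1r.
  have : y / u <= 1 by rewrite ler_pdivrMr// mul1r.
  by rewrite /t => ? ?; apply/andP; split; lra.
have := @convex_expR R (Itv01 (andP t01).1 (andP t01).2) (u * g) (- (u * g)).
rewrite !convRE/= -[unstable.onem t]/(1 - t).
have -> : t * (u * g) + (1 - t) * - (u * g) = y * g.
  by rewrite /t; field; rewrite gt_eqF.
move=> /le_trans; apply.
have -> : t * expR (u * g) + (1 - t) * expR (- (u * g)) =
   (expR (u * g) + expR (- (u * g))) / 2 +
   y * ((expR (u * g) - expR (- (u * g))) / (2 * u)).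
  by rewrite /t; field; rewrite gt_eqF.
by rewrite lerD2r ler_pdivrMr// (mulrC _ 2) cosh_le_expR_sqr.
Qed.

(** * Independence from the past of a sequence *)

(** These rectangles form a pi-system on which independence is a product formula; the sigma-algebra
    they generate is the past before time m. *)
Definition cylinders {d} {T : measurableType d} {R : realType}
    (Y : nat -> T -> R) (m : nat) : set (set T) :=
  [set A | exists2 B : nat -> set R, forall j, measurable (B j) &
    A = \bigcap_(j in `I_m) Y j @^-1` B j].

(* f is measurable with respect to the sigma-algebra of Y_0, ..., Y_(m-1). *)
Definition determined {d} {T : measurableType d} {R : realType}
    (Y : nat -> T -> R) (m : nat) (f : T -> R) : Prop :=
  measurable_fun (setT : set (g_sigma_algebraType (cylinders Y m)))
    (f : g_sigma_algebraType (cylinders Y m) -> R).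

Section independence.
Context {d d1 d2 : measure_display} {T : measurableType d}
  {T1 : measurableType d1} {T2 : measurableType d2} {R : realType}
  (P : probability T R).

(** Independence makes the joint law the product of the two laws; by Fubini the inner integral at
    fixed y is f(y) times the mean of h(X), which is 0. The two target spaces are arbitrary so that
    the second variable can later be the identity onto a coarser sigma-algebra. *)
Lemma integralM_indep (X : {mfun T >-> T1}) (Y : {mfun T >-> T2})
    (h : T1 -> R) (f : T2 -> R) :
  measurable_fun setT h -> measurable_fun setT f ->
  (forall A B, measurable A -> measurable B ->
    (P (X @^-1` A `&` Y @^-1` B) = P (X @^-1` A) * P (Y @^-1` B))%E) ->
  P.-integrable setT (fun w => (h (X w))%:E) ->
  P.-integrable setT (fun w => (h (X w) * f (Y w))%:E) ->
  (\int[P]_w (h (X w))%:E = 0)%E ->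
  (\int[P]_w (h (X w) * f (Y w))%:E = 0)%E.
Proof.
move=> mh mf indep ih ihf h0.
have mXY : measurable_fun setT (fun w => (X w, Y w)).
  exact: measurable_fun_pair.
pose XY : {mfun T >-> (T1 * T2)%type} :=
  HB.pack (fun w => (X w, Y w)) (isMeasurableFun.Build _ _ _ _ _ mXY).
pose mu := distribution P XY.
pose nu := (distribution P X \x distribution P Y)%E.
have nuE A : measurable A -> nu A = mu A.
  exact: product_measure_unique.
pose g (z : T1 * T2) : \bar R := (h z.1 * f z.2)%:E.
have mg : measurable_fun [set: T1 * T2] g.
  apply/measurable_EFinP; apply: measurable_funM.
    exact: (measurableT_comp mh measurable_fst).
  exact: (measurableT_comp mf measurable_snd).
have ig : nu.-integrable setT g.
  apply/integrableP; split => //.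
  rewrite (@eq_measure_integral _ _ _ _ mu); last by move=> A mA _; exact: nuE.
  by have /integrableP[] := @integrable_pushforward _ _ _ _ _ _ mXY P setT _ mg ihf measurableT.
have -> : (\int[P]_w (h (X w) * f (Y w))%:E = \int[nu]_z g z)%E.
  rewrite (@eq_measure_integral _ _ _ _ mu); last by move=> A mA _; exact: nuE.
  by rewrite integral_distribution.
rewrite -integral21_prod_meas1//; apply: integral0_eq => y _.
rewrite /fubini_G /g/= -[X in _ = X](mul0e (f y)%:E) -h0.
rewrite -(@integral_distribution _ _ _ _ _ P X (fun x => (h x)%:E))//; last first.
  exact/measurable_EFinP.
rewrite -integralZr//; apply: integrable_pushforward => //.
exact/measurable_EFinP.
Qed.
End independence.

Section cylinders.
Context {d : measure_display} {T : measurableType d} {R : realType}.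
Variables (Y : nat -> {mfun T >-> R}).
Implicit Types (f g : T -> R) (m : nat).

Lemma setI_closed_cylinders m : setI_closed (cylinders Y m).
Proof.
move=> _ _ [B mB ->] [C mC ->]; exists (fun j => B j `&` C j).
  by move=> j; exact: measurableI.
by rewrite -bigcapI; apply: eq_bigcapr => j _; rewrite preimage_setI.
Qed.

Lemma setT_cylinders m : cylinders Y m setT.
Proof.
exists (fun=> setT) => //; apply/esym; rewrite -subTset => w _ j _ //.
Qed.

Lemma cylinders_measurable m : cylinders Y m `<=` measurable.
Proof.
move=> _ [B mB ->]; apply: fin_bigcap_measurable => // j _.
by rewrite -[X in measurable X]setTI; exact: measurable_funP.
Qed.

Lemma cylinders_le m n : (m <= n)%N -> cylinders Y m `<=` cylinders Y n.
Proof.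
move=> mn _ [B mB ->]; exists (fun j => if (j < m)%N then B j else setT).
  by move=> j; case: ifP.
apply/seteqP; split => w /= h j /= jn.
  by case: ifP => // jm; exact: h.
by have := h _ (leq_trans jn mn); rewrite jn.
Qed.

Lemma determined_le m n f : (m <= n)%N -> determined Y m f -> determined Y n f.
Proof.
move=> mn mf _ B mB.
have := mf measurableT B mB.
by move: (_ `&` _); apply: sub_sigma_algebra2; exact: cylinders_le.
Qed.

Lemma determined_measurable m f : determined Y m f -> measurable_fun setT f.
Proof.
move=> mf _ B mB.
have := mf measurableT B mB; apply: smallest_sub; last exact: cylinders_measurable.
exact: sigma_algebra_measurable.
Qed.

Lemma determined_coord m j : (j < m)%N -> determined Y m (Y j).
Proof.
move=> jm _ B mB; apply: sub_sigma_algebra.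
exists (fun i => if i == j then B else setT); first by move=> i; case: ifP.
rewrite setTI; apply/seteqP; split => w /= h.
  by move=> i _ /=; case: eqP => [->|].
by have := h j jm; rewrite /= eqxx.
Qed.

(** As functions of E, both sides are finite measures that agree on the pi-system of cylinders,
    hence on the sigma-algebra it generates. The right side is P scaled by the number P(D). *)
Lemma indep_sigma_cylinders (P : probability T R) m (D : set T) :
  measurable D ->
  (forall C, cylinders Y m C -> P (C `&` D) = P C * P D)%E ->
  forall E, <<s cylinders Y m >> E -> (P (E `&` D) = P E * P D)%E.
Proof.
move=> mD indep E mE.
have PD0 : (0 <= fine (P D))%R by exact: fine_ge0.
have scaleE A : (mscale (NngNum PD0) P A = P A * P D)%E.
  by rewrite /mscale /= fineK ?fin_num_measure// muleC.
rewrite -scaleE -[LHS]/(mrestr P mD E).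
apply: (@g_sigma_algebra_measure_unique _ _ _ (cylinders Y m) _ (fun=> setT)) => //.
- exact: cylinders_measurable.
- by move=> _; exact: setT_cylinders.
- by rewrite bigcup_const.
- exact: setI_closed_cylinders.
- by move=> C mC; rewrite /mrestr [RHS]scaleE; exact: indep.
- move=> _; rewrite -[X in (X < _)%E]/(P (setT `&` D)) ltey_eq.
  by rewrite fin_num_measure//; exact: measurableI.
Qed.

End cylinders.

(** * Azuma's inequality for martingale transforms *)

Section azuma.
Context {d : measure_display} {T : measurableType d} {R : realType}
  (P : probability T R).

Lemma integrable_bounded (f : T -> R) (M : R) : measurable_fun setT f ->
  (forall w, `|f w| <= M) -> P.-integrable setT (EFin \o f).
Proof.
move=> mf fM; apply: measurable_bounded_integrable => //.
  by rewrite -ge0_fin_numE// fin_num_measure.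
exists M; split; first exact: num_real.
by move=> x Mx w _; rewrite /= (le_trans (fM w))// ltW.
Qed.

Variables (Y : nat -> {mfun T >-> R}) (N : nat) (u : R).
Hypothesis u0 : 0 < u.
Hypothesis indep : forall m C B, (m < N)%N -> cylinders Y m C ->
  measurable B -> (P (C `&` Y m @^-1` B) = P C * P (Y m @^-1` B))%E.
Hypothesis mean0 : forall m, (m < N)%N -> (\int[P]_w (Y m w)%:E = 0)%E.
Hypothesis Yu : forall m, (m < N)%N -> forall w, `|Y m w| <= u.

Lemma integralM_determined m (K : T -> R) (M : R) : (m < N)%N ->
  determined Y m K -> (forall w, `|K w| <= M) ->
  (\int[P]_w (Y m w * K w)%:E = 0)%E.
Proof.
move=> mN mK KM; pose F := g_sigma_algebraType (cylinders Y m).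
have mid : measurable_fun setT (id : T -> F).
  move=> _ B mB; rewrite setTI preimage_id.
  by apply: smallest_sub mB;
    [exact: sigma_algebra_measurable | exact: cylinders_measurable].
(* The whole past as one random variable: [K] is a measurable function of [I], so the case of two
   independent variables applies to [Y m] and [I]. *)
pose I : {mfun T >-> F} :=
  HB.pack (id : T -> F) (isMeasurableFun.Build _ _ _ _ _ mid).
apply: (@integralM_indep _ _ _ T _ F R P (Y m) I id K) => //.
- move=> A B mA mB; rewrite setIC muleC.
  apply: (@indep_sigma_cylinders _ _ _ Y P m) => //.
    by rewrite -[X in measurable X]setTI; exact: measurable_funP.
  by move=> C mC; exact: indep.
- by apply: (@integrable_bounded _ u) => // w; exact: Yu.
- apply: (@integrable_bounded _ (u * M)) => [|w /=].
    by apply: measurable_funM => //; exact: determined_measurable mK.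
  by rewrite normrM ler_pM// Yu.
- exact: mean0.
Qed.

Section transform.
Variables (G : nat -> T -> R) (c : nat -> R).
Hypothesis mG : forall m, (m < N)%N -> determined Y m (G m).
Hypothesis Gc : forall m, (m < N)%N -> forall w, `|G m w| <= c m.

Let S m w := \sum_(i < m) Y i w * G i w.

Lemma determined_transform m : (m <= N)%N -> determined Y m (S m).
Proof.
move=> mN; apply: measurable_sum => i; apply: measurable_funM.
  exact: determined_coord.
apply: (determined_le (ltnW (ltn_ord i))); apply: mG.
exact: leq_trans (ltn_ord i) mN.
Qed.

(** By induction, with no conditional expectation: the chord bound splits the new exponential into a
    constant multiple of the old one plus [Y m] times a coefficient known from the past, and the
    latter has mean zero. *)
Lemma expectation_expR_transform m : (m <= N)%N ->
  (\int[P]_w (expR (S m w))%:E <=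
   (expR (\sum_(i < m) (u * c i) ^+ 2 / 2))%:E)%E.
Proof.
elim: m => [|m IH] mN.
  under eq_integral do rewrite /S big_ord0.
  by rewrite integral_cst//= probability_setT mule1 big_ord0.
have dS := determined_transform (ltnW mN).
have dG := mG mN.
have dE (f : T -> R) : determined Y m f -> determined Y m (expR \o f).
  by move=> df; exact: measurableT_comp.
(* The slope of the chord for [G m w], times the exponential already accumulated. *)
pose K w := expR (S m w) *
  ((expR (u * G m w) - expR (- (u * G m w))) / (2 * u)).
have dK : determined Y m K.
  apply: measurable_funM; first exact: (dE (S m)).
  apply: measurable_funM => //; apply: measurable_funB.
    by apply: (dE (fun w => u * G m w)); exact: measurable_funM.
  apply: (dE (fun w => - (u * G m w))).
  by apply: measurableT_comp => //; exact: measurable_funM.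
(* Crude uniform bounds; they serve only to make the integrands integrable. *)
pose M := \sum_(i < m) u * c i.
have SM w : `|S m w| <= M.
  rewrite (le_trans (ler_norm_sum _ _ _))//; apply: ler_sum => i _.
  have iN := ltn_trans (ltn_ord i) mN.
  by rewrite normrM ler_pM// ?Yu ?Gc.
have eSM w : `|expR (S m w)| <= expR M.
  by rewrite ger0_norm ?expR_ge0// ler_expR (le_trans (ler_norm _)).
have KM w : `|K w| <= expR M * ((expR (u * c m) + expR (u * c m)) / (2 * u)).
  rewrite normrM ler_pM// normrM [X in _ * X]gtr0_norm ?invr_gt0 ?mulr_gt0//.
  rewrite ler_pM2r ?invr_gt0 ?mulr_gt0// (le_trans (ler_normB _ _))//.
  have := Gc mN w; rewrite ler_norml => /andP[? ?].
  rewrite !ger0_norm ?expR_ge0// lerD// ler_expR -?mulrN ler_pM2l//.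
  by rewrite lerNl.
set a := expR ((u * c m) ^+ 2 / 2).
have step w : expR (S m.+1 w) <= a * expR (S m w) + Y m w * K w.
  rewrite /S big_ord_recr/= -/(S m w) expRD.
  have := expRM_le_chord (G m w) u0 (Yu mN w).
  move=> /(ler_wpM2l (expR_ge0 (S m w))) /le_trans; apply.
  rewrite mulrDr lerD//; last by rewrite /K mulrCA.
  rewrite mulrC ler_wpM2r ?expR_ge0// ler_expR ler_pM2r//.
  rewrite -real_normK ?num_real// -[leRHS]real_normK ?num_real//.
  rewrite lerXn2r ?nnegrE// !normrM ler_wpM2l// (le_trans (Gc mN w))//.
  exact: ler_norm.
have iS := @integrable_bounded (expR \o S m) (expR M)
  (determined_measurable (dE _ dS)) eSM.
have iYK : P.-integrable setT (fun w => (Y m w * K w)%:E).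
  apply: (@integrable_bounded _ (u * (expR M * ((expR (u * c m) + expR (u * c m)) / (2 * u))))).
    by apply: measurable_funM => //; exact: determined_measurable dK.
  by move=> w; rewrite normrM ler_pM ?Yu.
apply: (@le_trans _ _ (\int[P]_w (a%:E * (expR (S m w))%:E + (Y m w * K w)%:E))%E).
  apply: ge0_le_integral => //.
  - apply/measurable_EFinP; apply: measurableT_comp => //.
    exact: determined_measurable (determined_transform mN).
  - apply: emeasurable_funD; last exact: measurable_int iYK.
    by apply: measurable_funeM; exact: measurable_int iS.
  - by move=> w _; rewrite -EFinM -EFinD lee_fin.
rewrite integralD//; last exact: integrableZl.
rewrite (integralM_determined mN dK KM) adde0 integralZl//.
rewrite big_ord_recr/= expRD EFinM muleC lee_wpmul2r ?lee_fin ?expR_ge0//.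
exact: IH (ltnW mN).
Qed.
End transform.

Lemma azuma_tail (G : nat -> T -> R) (c : nat -> R) (l : R) : 0 < l ->
  (forall m, (m < N)%N -> determined Y m (G m)) ->
  (forall m, (m < N)%N -> forall w, `|G m w| <= c m) ->
  (P [set w | (u * Num.sqrt (\sum_(i < N) c i ^+ 2) * l <
               \sum_(i < N) Y i w * G i w)%R] <= (expR (- (l ^+ 2 / 2)))%:E)%E.
Proof.
move=> l0 mG Gc; set V := \sum_(i < N) c i ^+ 2; set s := u * Num.sqrt V.
pose S w := \sum_(i < N) Y i w * G i w.
have V0 : 0 <= V by apply: sumr_ge0 => i _; exact: sqr_ge0.
have mS : measurable_fun setT S.
  by apply: determined_measurable (determined_transform mG (leqnn N)).
have s2 : s ^+ 2 = u ^+ 2 * V by rewrite exprMn sqr_sqrtr.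
(* For V = 0 the rate l / s below would divide by zero; all coefficients vanish then, and the strict
   inequality makes the event empty. *)
have [V_eq0|V_neq0] := eqVneq V 0.
  have c0 (i : 'I_N) : c i = 0.
    have /psumr_eq0P := V_eq0 => /(_ (fun i _ => sqr_ge0 _) i isT) /eqP.
    by rewrite sqrf_eq0 => /eqP.
  rewrite [X in P X](_ : _ = set0) ?measure0 ?lee_fin ?expR_ge0//.
  rewrite -subset0 => w /=; rewrite /s V_eq0 sqrtr0 mulr0 mul0r.
  rewrite big1 ?ltxx// => i _.
  have := Gc i (ltn_ord i) w; rewrite c0 normr_le0 => /eqP ->.
  by rewrite mulr0.
have s0 : 0 < s by rewrite mulr_gt0// sqrtr_gt0 lt_neqAle eq_sym V_neq0.
(* The Chernoff rate minimising r^2 s^2 / 2 - r s l, with minimum -l^2 / 2. *)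
pose r := l / s; have r0 : 0 < r by rewrite divr_gt0.
pose SRV : {RV P >-> R} := HB.pack S (isMeasurableFun.Build _ _ _ _ _ mS).
apply: (@le_trans _ _ (P [set w | (s * l <= SRV w)%R])).
  apply: le_measure; rewrite ?inE.
  - by rewrite -[X in measurable X]setTI; exact: measurable_fun_ltr.
  - by rewrite -[X in measurable X]setTI; exact: measurable_fun_ler.
  - by move=> w /= /ltW.
apply: (le_trans (chernoff _ _ r0)).
rewrite /mmt_gen_fun unlock /=.
have mrG m : (m < N)%N -> determined Y m (fun w => r * G m w).
  by move=> mN; apply: measurable_funM => //; exact: mG.
have rGc m : (m < N)%N -> forall w, `|r * G m w| <= r * c m.
  by move=> mN w; rewrite normrM gtr0_norm// ler_pM2l// Gc.
have := expectation_expR_transform mrG rGc (leqnn N).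
under eq_integral => w _.
  rewrite (_ : \sum_(i < N) _ = S w * r); last first.
    by rewrite mulr_suml; apply: eq_bigr => i _; rewrite (mulrC r) mulrA.
  over.
move=> h; apply: (le_trans (lee_wpmul2r _ h)); first by rewrite lee_fin expR_ge0.
rewrite -EFinM -expRD lee_fin ler_expR.
have -> : \sum_(i < N) (u * (r * c i)) ^+ 2 / 2 = r ^+ 2 * s ^+ 2 / 2.
  rewrite s2 -mulr_suml; congr (_ / _); rewrite /V 2!mulr_sumr.
  by apply: eq_bigr => i _; rewrite !exprMn mulrCA.
by rewrite -exprMn /r mulrA divfK ?gt_eqF//; lra.
Qed.
End azuma.

(** * The rounding error as a backward transform *)

(** Unrolls the recursion E_(k+1) = (1 + delta_(k+1)) E_k + s_(k+1) delta_(k+1). The index i counts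
    back from the last step, so the product over j < i collects the later roundings. *)
Lemma shat_error {d : measure_display} {T : measurableType d} {R : realType}
    (x : nat -> R) (delta : nat -> T -> R) (k : nat) (w : T) :
  shat x delta k.+1 w - psum x k.+1 =
  \sum_(i < k) delta (k.+1 - i)%N w *
    (psum x (k.+1 - i) * \prod_(j < i) (1 + delta (k.+1 - j)%N w)).
Proof.
elim: k => [|k IH]; first by rewrite big_ord0 /= /psum big_nat1 subrr.
(* The term i = 0 is the newest rounding; after a shift of index the others share the factor 1 +
   delta_(k+2) and sum to the previous error. *)
rewrite big_ord_recl/= big_ord0 mulr1 subn0.
under eq_bigr do rewrite big_ord_recl/= mulrCA [X in _ * X]mulrCA subn0.
have -> : psum x k.+2 = psum x k.+1 + x k.+2 by rewrite /psum big_nat_recr.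
under eq_bigr do under eq_bigr do rewrite /bump/= add1n subSS.
under eq_bigr do rewrite /bump/= add1n subSS mulrCA.
rewrite -mulr_sumr.
under eq_bigr do rewrite mulrCA.
rewrite -IH /=; ring.
Qed.

(** * Stopping when a partial sum exceeds t *)

Section stopping.
Context {d : measure_display} {T : measurableType d} {R : realType}.
Variables (Y : nat -> {mfun T >-> R}) (t : R).

Definition partial_sum (m : nat) (w : T) : R := \sum_(j < m) Y j w.

(** The indicator of not having stopped by time m. The range [m.+1] includes [partial_sum m], which
    involves [Y j] for j < m only, so [alive m] is an admissible coefficient of [Y m]. *)
Definition alive (m : nat) (w : T) : R :=
  \prod_(j < m.+1) (if partial_sum j w <= t then 1 else 0).

Lemma determined_partial_sum m : determined Y m (partial_sum m).
Proof. by apply: measurable_sum => j; exact: determined_coord. Qed.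

Lemma determined_alive m : determined Y m (alive m).
Proof.
apply: measurable_prod => j _; apply: measurable_fun_ifT => //.
apply: measurable_fun_ler => //.
have jm : (j <= m)%N by rewrite -ltnS.
exact: determined_le jm (@determined_partial_sum j).
Qed.

Lemma normr_alive_le1 m w : `|alive m w| <= 1.
Proof.
rewrite normr_prod; apply: prodr_ile1 => j _; rewrite normr_ge0/=.
by case: ifP; rewrite ?normr1 ?normr0 ?lexx ?ler01.
Qed.

Lemma alive_exceed m w : t < partial_sum m w -> alive m w = 0.
Proof. by rewrite ltNge => /negbTE tS; rewrite /alive big_ord_recr/= tS mulr0. Qed.

(* The stopped sum freezes at its first value above t, so it ends above t as soon
   as some partial sum does: this replaces a maximal inequality. *)
Lemma aliveP m w : 0 <= t ->
  \sum_(i < m) Y i w * alive i w <= t -> forall i, (i <= m)%N -> alive i w = 1.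
Proof.
move=> t0.
(* The invariant for the induction: either nothing has stopped and the stopped sum is the partial
   sum, or it is frozen above t because later coefficients vanish. *)
suff H : (forall i, (i <= m)%N -> alive i w = 1) /\
      \sum_(i < m) Y i w * alive i w = partial_sum m w \/
    alive m w = 0 /\ t < \sum_(i < m) Y i w * alive i w.
  by move=> Wt; case: H => [[]//|[_]]; rewrite ltNge Wt.
elim: m => [|m IH].
  left; split; last by rewrite /partial_sum !big_ord0.
  by case=> // _; rewrite /alive big_ord1 /partial_sum big_ord0 t0.
have aS : alive m.+1 w = alive m w * (if partial_sum m.+1 w <= t then 1 else 0).
  by rewrite /alive big_ord_recr.
rewrite big_ord_recr/=; case: IH => [[a1 WS]|[a0 tW]]; last first.
  by right; rewrite aS a0 mul0r mulr0 addr0.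
have W1 : \sum_(i < m) Y i w * alive i w + Y m w * alive m w =
    partial_sum m.+1 w.
  by rewrite WS a1// mulr1 /partial_sum big_ord_recr.
rewrite W1; case: (leP (partial_sum m.+1 w) t) => St; [left|right].
  split=> // i; rewrite leq_eqVlt => /predU1P[->|]; last by rewrite ltnS; exact: a1.
  by rewrite aS a1// St mulr1.
by split => //; exact: alive_exceed.
Qed.

Lemma alive_prod_le m w : (forall j, (j < m)%N -> -1 <= Y j w) ->
  `|alive m w * \prod_(j < m) (1 + Y j w)| <= expR t.
Proof.
move=> Y1; case: (leP (partial_sum m w) t) => St; last first.
  by rewrite alive_exceed// mul0r normr0 expR_ge0.
rewrite normrM -[leRHS]mul1r ler_pM// ?normr_alive_le1//.
rewrite normr_prod (le_trans _ (_ : expR (partial_sum m w) <= _)) ?ler_expR//.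
rewrite expR_sum; apply: ler_prod => j _; rewrite normr_ge0/=.
rewrite ger0_norm ?expR_ge1Dx//; have := Y1 _ (ltn_ord j); lra.
Qed.

End stopping.

(** * Independence after time reversal *)

Section reversed_independence.
Context {d : measure_display} {T : measurableType d} {R : realType}.

Lemma mutually_independent_rev (P : probability T R) (N : nat)
    (X : nat -> {RV P >-> R}) :
  mutually_independent P [set k | (2 <= k <= N.+1)%N] X ->
  forall m C B, (m < N)%N -> cylinders (fun i => X (N.+1 - i)%N) m C ->
  measurable B ->
  (P (C `&` X (N.+1 - m)%N @^-1` B) = P C * P (X (N.+1 - m)%N @^-1` B))%E.
Proof.
move=> indep; have prodE m (B : nat -> set R) : (m <= N)%N ->
    (forall j, measurable (B j)) ->
    (P (\bigcap_(j in `I_m) X (N.+1 - j)%N @^-1` B j) =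
     \prod_(j < m) P (X (N.+1 - j)%N @^-1` B j))%E.
  move=> mN mB.
  have subK j : (j < m)%N -> (N.+1 - (N.+1 - j) = j)%N.
    by move=> jm; rewrite subKn// ltnW// ltnS (leq_trans _ mN)// ltnW.
  pose J := [seq (N.+1 - j)%N | j <- index_iota 0 m].
  have uJ : uniq J.
    rewrite map_inj_in_uniq ?iota_uniq// => i j.
    by rewrite !mem_index_iota => im jm /(congr1 (subn N.+1)); rewrite !subK.
  have J2 k : k \in J -> (2 <= k <= N.+1)%N.
    move=> /mapP[j]; rewrite mem_index_iota => jm ->.
    by rewrite leq_subr andbT ltn_subRL addn1 ltnS (leq_trans jm mN).
  have := indep J uJ J2 (fun k => B (N.+1 - k)%N) (fun k => mB _).
  rewrite big_map big_mkord.
  under [X in _ = X -> _]eq_bigr => j _ do rewrite subK//.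
  move=> <-; congr (P _); apply/seteqP; split => w /= h.
    by move=> i /= /mapP[j]; rewrite mem_index_iota => jm ->; rewrite subK//; exact: h.
  move=> j jm; rewrite /= -[in B j](subK j jm); apply: h.
  by apply/mapP; exists j => //; rewrite mem_index_iota.
move=> m _ B mN [B' mB' ->] mB.
(* Placing [B] at index m turns the intersection into a cylinder of length [m.+1], whose last factor
   is split off. *)
have := prodE m.+1 (fun j => if j == m then B else B' j) mN.
rewrite big_ord_recr/= eqxx => h.
rewrite prodE//; last exact: ltnW.
rewrite [X in (X * _)%E](_ : _ = (\prod_(j < m) P (X (N.+1 - j)%N @^-1` (if (j : nat) == m then B else B' j)))%E); last first.
  by apply: eq_bigr => j _; rewrite ltn_eqF.
rewrite -h; last by move=> j; case: ifP.
congr (P _); apply/seteqP; split => w /=.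
  move=> [h1 h2] j /=; rewrite ltnS leq_eqVlt; case: eqP => [->//|_ /= jm].
  exact: h1.
move=> h1; split => [j /= jm|].
  by have := h1 j; rewrite /= ltnS (ltnW jm) ltn_eqF//; exact.
by have := h1 m; rewrite /= ltnS leqnn eqxx; exact.
Qed.
End reversed_independence.

(** * The constants, and the final union bound *)

Lemma snorm_rev (R : realType) (x : nat -> R) (N : nat) :
  \sum_(i < N) psum x (N.+1 - i) ^+ 2 = snorm x N.+1 ^+ 2.
Proof.
rewrite /snorm sqr_sqrtr ?sumr_ge0// => [|i _]; last exact: sqr_ge0.
by rewrite big_rev_mkord; have -> : (N.+2 - 2 = N)%N by rewrite subn2.
Qed.

Lemma measurable_shat {d : measure_display} {T : measurableType d}
    {R : realType} (x : nat -> R) (delta : nat -> {mfun T >-> R}) (k : nat) :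
  measurable_fun setT (shat x (fun k => delta k : T -> R) k).
Proof.
case: k => [|k]; first exact: measurable_cst.
elim: k => [|k IH]; first exact: measurable_cst.
by apply: measurable_funM; apply: measurable_funD.
Qed.

Lemma lam_gt0 (R : realType) (dl : R) : 0 < dl -> dl < 1 -> 0 < lam dl.
Proof.
move=> d0 d1; rewrite sqrtr_gt0 mulr_gt0// ln_gt0//.
by rewrite ltr_pdivlMr// mul1r (lt_trans d1)// ltr1n.
Qed.

(** [lam dl] is the level at which the one-sided Azuma tail is exactly dl/2. *)
Lemma expR_lam (R : realType) (dl : R) : 0 < dl -> dl < 1 ->
  expR (- (lam dl ^+ 2 / 2)) = dl / 2.
Proof.
move=> d0 d1; have := lam_gt0 d0 d1; rewrite sqrtr_gt0 => l0.
rewrite sqr_sqrtr; last exact: ltW.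
rewrite mulrC mulKf ?gt_eqF// expRN lnK ?invf_div// posrE.
by rewrite divr_gt0.
Qed.

Theorem theorem3p3 (d : measure_display) (T : measurableType d) (R : realType)
  (P : probability T R) (n : nat) (x : nat -> R) (u : R)
  (delta : nat -> {RV P >-> R}) (dl : R) :
  (1 <= n)%N ->
  0 < u -> u < 1 ->
  mutually_independent P [set k | (2 <= k <= n)%N] delta ->
  (forall k, (2 <= k <= n)%N -> ('E_P[delta k] = 0)%E) ->
  (forall k, (2 <= k <= n)%N -> forall w, `|delta k w| <= u) ->
  0 < dl -> dl < 1 ->
  ((1 - dl)%:E <=
   P [set w | (`|shat x (fun k => delta k : T -> R) n w - psum x n|
              <= u * snorm x n * lam (dl / 2) * (1 + gtilde n u (dl / 2)))%R])%E.
Proof.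
case: n => // N _ u0 u1 indep mean0 du dl0 dl1.
set l := lam (dl / 2).
have h0 : 0 < dl / 2 by rewrite divr_gt0.
have h1 : dl / 2 < 1 by rewrite ltr_pdivrMr// mul1r (lt_trans dl1)// ltr1n.
have l0 : 0 < l by exact: lam_gt0.
(* Azuma's threshold for N summands with coefficients bounded by 1; N = n - 1 is the number of
   roundings. *)
pose t := u * Num.sqrt N%:R * l.
have t0 : 0 <= t by rewrite !mulr_ge0 ?sqrtr_ge0// ltW.
pose Y i := delta (N.+1 - i)%N.
have Yrange i : (i < N)%N -> (2 <= N.+1 - i <= N.+1)%N.
  by move=> iN; rewrite leq_subr andbT ltn_subRL addn1 ltnS.
have Yindep := mutually_independent_rev indep.
have Ymean i : (i < N)%N -> (\int[P]_w (Y i w)%:E = 0)%E.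
  by move=> iN; rewrite -expectation_def mean0// Yrange.
have Yu i : (i < N)%N -> forall w, `|Y i w| <= u.
  by move=> iN; apply: du; exact: Yrange.
pose p i w := \prod_(j < i) (1 + Y j w).
pose D i w := psum x (N.+1 - i) * (alive Y t i w * p i w).
have mp i : determined Y i (p i).
  apply: measurable_prod => j _; apply: measurable_funD => //.
  exact: determined_coord.
have mD i : determined Y i (D i).
  apply: measurable_funM => //; apply: measurable_funM; last exact: mp.
  exact: determined_alive.
pose c i := `|psum x (N.+1 - i)| * expR t.
have Dc : forall m, (m < N)%N -> forall w, `|D m w| <= c m.
  move=> i iN w; rewrite normrM ler_wpM2l// alive_prod_le// => j ji.
  have := Yu _ (ltn_trans ji iN) w; rewrite ler_norml => /andP[+ _].
  by apply: le_trans; rewrite lerN2 ltW.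
have sqrt_c : u * Num.sqrt (\sum_(i < N) c i ^+ 2) * l =
    u * snorm x N.+1 * l * expR t.
  under eq_bigr do rewrite exprMn real_normK ?num_real//.
  rewrite -mulr_suml snorm_rev -exprMn sqrtr_sqr ger0_norm; first by ring.
  by rewrite mulr_ge0 ?expR_ge0// sqrtr_ge0.
pose W w := \sum_(i < N) Y i w * alive Y t i w.
pose Z w := \sum_(i < N) Y i w * D i w.
pose tau := u * snorm x N.+1 * l * expR t.
have mW : measurable_fun setT W.
  apply: measurable_sum => i; apply: measurable_funM => //.
  by apply: determined_measurable; exact: determined_alive.
have mZ : measurable_fun setT Z.
  apply: measurable_sum => i; apply: measurable_funM => //.
  by apply: determined_measurable; exact: mD.
(* One halving comes from [lam (dl / 2)], the other from [expR_lam]. *)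
have tailE : expR (- (l ^+ 2 / 2)) = dl / 4.
  by rewrite expR_lam// -mulrA -invfM -natrM.
have PW : (P [set w | (t < W w)%R] <= (dl / 4)%:E)%E.
  have := azuma_tail u0 Yindep Ymean Yu l0 (fun m _ => @determined_alive _ _ _ Y t m)
    (fun m _ => @normr_alive_le1 _ _ _ Y t m).
  rewrite tailE; under eq_bigr do rewrite expr1n.
  by rewrite sumr_const card_ord.
have PZ : (P [set w | (tau < Z w)%R] <= (dl / 4)%:E)%E.
  have := azuma_tail u0 Yindep Ymean Yu l0 (fun m _ => mD m) Dc.
  by rewrite tailE sqrt_c.
(* The lower tail is the upper tail for the negated coefficients. *)
have PNZ : (P [set w | (tau < - Z w)%R] <= (dl / 4)%:E)%E.
  have mND i : (i < N)%N -> determined Y i (fun w => - D i w).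
    by move=> _; apply: measurableT_comp => //; exact: mD.
  have NDc i : (i < N)%N -> forall w, `|- D i w| <= c i.
    by move=> iN w; rewrite normrN Dc.
  have := azuma_tail u0 Yindep Ymean Yu l0 mND NDc.
  rewrite tailE sqrt_c.
  by under eq_set => w do [under eq_bigr do rewrite mulrN; rewrite sumrN].
(* Since 1 + [gtilde] is an exponential, only exponents are compared: replacing N by n, adding n u^2
   and dividing by 1 - u < 1 all enlarge t. *)
have tau_le : tau <= u * snorm x N.+1 * l * (1 + gtilde N.+1 u (dl / 2)).
  have k0 : 0 <= u * snorm x N.+1 * l by rewrite !mulr_ge0 ?sqrtr_ge0// ltW.
  rewrite ler_wpM2l// /gtilde addrC subrK ler_expR.
  rewrite ler_pdivlMr ?subr_gt0// -/l.
  have tN : t <= l * Num.sqrt N.+1%:R * u.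
    rewrite /t (mulrC u) mulrAC (ler_wpM2r (ltW u0))// mulrC (ler_wpM2l (ltW l0))//.
    by rewrite ler_wsqrtr// ler_nat.
  rewrite (le_trans (_ : _ <= t))//.
    by rewrite ler_piMr// lerBlDr lerDl ltW.
  by rewrite (le_trans tN)// lerDl mulr_ge0// sqr_ge0.
set A := [set w | _].
have mA : measurable A.
  rewrite -[A]setTI; apply: measurable_fun_ler => //.
  apply: measurableT_comp => //; apply: measurable_funB => //.
  exact: measurable_shat.
pose BW := [set w | t < W w]; pose BZ := [set w | tau < Z w].
pose BN := [set w | tau < - Z w].
(* Outside [BW] no stopping occurs, so every [alive] factor is 1 and [Z] is the true error; outside
   [BZ] and [BN] it is at most [tau] in absolute value. *)
have sub : ~` A `<=` BW `|` BZ `|` BN.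
  move=> w /= Aw; apply: contrapT => /not_orP[/not_orP[/negP Ww /negP Zw] /negP NZw].
  apply: Aw; rewrite /A/=; apply: le_trans tau_le.
  rewrite shat_error.
  have al := aliveP t0 (_ : W w <= t).
  rewrite [X in `|X|](_ : _ = Z w); last first.
    apply: eq_bigr => i _; rewrite /D al ?mul1r//.
      by rewrite leNgt.
    exact: ltnW.
  by rewrite ler_norml lerNl !leNgt NZw Zw.
have mgt (f : T -> R) (a : R) : measurable_fun setT f ->
    measurable [set w | a < f w].
  by move=> mf; rewrite -[X in measurable X]setTI; exact: measurable_fun_ltr.
have mBW : measurable BW by exact: mgt.
have mBZ : measurable BZ by exact: mgt.
have mBN : measurable BN by apply: mgt; exact: measurableT_comp.
have mWZ : measurable (BW `|` BZ) by exact: measurableU.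
have PCA : (P (~` A) <= dl%:E)%E.
  apply: (@le_trans _ _ (P (BW `|` BZ `|` BN))).
    by apply: le_measure => //; rewrite inE; [exact: measurableC|exact: measurableU].
  (* Three tails of dl/4 each total 3 dl/4, within the allowed dl. *)
  apply: (@le_trans _ _ (dl / 4 + dl / 4 + dl / 4)%:E); last by rewrite lee_fin; lra.
  apply: (le_trans (measureU2 _ mWZ mBN)); rewrite !EFinD leeD//.
  by apply: (le_trans (measureU2 _ mBW mBZ)); rewrite leeD.
rewrite -[A]setCK probability_setC; last exact: measurableC.
by rewrite EFinB leeB.
Qed.
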